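(* Let $O_{A_{\mathbb{N}}}$ be the universal $C^*$-algebra generated by partial isometries $\{s_i:i=0,1,2,\ldots\}$ satisfying $s_i^*s_j=0$ for $i\neq j$ and $s_i^*s_i=\sum_{k=0}^i s_ks_k^*$ for all $i\geq 0$. If $\pi$ is an irreducible representation of $O_{A_{\mathbb{N}}}$, then there exists $n\geq 0$ such that $\pi\cong\widetilde{\pi}_{n,z}$ (unitary equivalence) for some $z\in\mathbb{T}$.
   Context: $\mathbb{T}$ is the unit circle in $\mathbb{C}$, $\mathbb{N}=\{1,2,\ldots\}$. The weakly monotone Fock space $\mathcal{F}_{wm}(\ell^2(\mathbb{N}))$ is the Hilbert space with orthonormal basis the vacuum $\Omega$ and all $e_{i_1}\otimes\cdots\otimes e_{i_k}$, $k\geq 1$, $i_1\geq\cdots\geq i_k\geq 1$ (a closed subspace of the full Fock space over $\ell^2(\mathbb{N})$). For $i\in\mathbb{N}$, $A_i^\dagger\Omega=e_i$ and $A_i^\dagger\, e_{i_1}\otimes\cdots\otimes e_{i_k}=e_i\otimes e_{i_1}\otimes\cdots\otimes e_{i_k}$ if $i\geq i_1$ and $0$ otherwise. $P_\Omega$ is the projection onto $\mathbb{C}\Omega$. For $z\in\mathbb{T}$, $\widetilde{\pi}_{0,z}: O_{A_{\mathbb{N}}}\to\mathcal{B}(\mathcal{F}_{wm}(\ell^2(\mathbb{N})))$ is the representation with $\widetilde{\pi}_{0,z}(s_0)=zP_\Omega$ and $\widetilde{\pi}_{0,z}(s_i)=A_i^\dagger$ for $i\geq 1$. For $n\geq 1$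 let $J_n\subset O_{A_{\mathbb{N}}}$ be the closed two-sided ideal generated by $\{s_0,\ldots,s_{n-1}\}$, $p_n:O_{A_{\mathbb{N}}}\to O_{A_{\mathbb{N}}}/J_n$ the quotient map, and $\Psi_n:O_{A_{\mathbb{N}}}\to O_{A_{\mathbb{N}}}/J_n$ the $*$-isomorphism determined by $\Psi_n(s_i)=[s_{i+n}]_{J_n}$, $i\geq 0$. For $n\geq 1$ and $z\in\mathbb{T}$ define $\widetilde{\pi}_{n,z}:=\widetilde{\pi}_{0,z}\circ\Psi_n^{-1}\circ p_n$ (explicitly, $\widetilde{\pi}_{n,z}(s_i)=0$ for $i<n$, $\widetilde{\pi}_{n,z}(s_n)=zP_\Omega$, $\widetilde{\pi}_{n,z}(s_{n+i})=A_i^\dagger$ for $i\geq 1$). *)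

(* Defs.v *)
From HB Require Import structures.
From mathcomp Require Import all_boot all_order all_algebra.
From mathcomp Require Import complex.
From mathcomp Require Import all_classical all_reals all_analysis.
From mathcomp Require Import ring.

Set Implicit Arguments.
Unset Strict Implicit.
Unset Printing Implicit Defensive.

Import Order.TTheory GRing.Theory Num.Theory.
Import numFieldNormedType.Exports.

Local Open Scope classical_set_scope.
Local Open Scope ring_scope.
Local Open Scope complex_scope.

(** * Hilbert spaces and C*-algebras over [R[i]] *)

(* The form is linear in its first argument. *)
HB.mixin Record CompleteNormedModule_isHilbert (R : realType) H
    of CompleteNormedModule R[i] H := {
  inner : {dot H for (@Num.conj R[i])};
  inner_norm : forall x : H, inner x x = `|x| ^+ 2
}.

#[short(type="hilbertType")]
HB.structure Definition Hilbert (R : realType) :=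
  {H of CompleteNormedModule R[i] H & CompleteNormedModule_isHilbert R H}.

(* MathComp rings are unital while C*-algebras need not be, so the product is
   a field of its own. *)
HB.mixin Record CompleteNormedModule_isCStar (R : realType) A
    of CompleteNormedModule R[i] A := {
  cmul : A -> A -> A;
  star : A -> A;
  cmulA : associative cmul;
  cmulDl : left_distributive cmul +%R;
  cmulDr : right_distributive cmul +%R;
  cmulZl : forall (c : R[i]) (a b : A), cmul (c *: a) b = c *: cmul a b;
  cmulZr : forall (c : R[i]) (a b : A), cmul a (c *: b) = c *: cmul a b;
  starK : involutive star;
  starD : {morph star : a b / a + b};
  starZ : forall (c : R[i]) (a : A), star (c *: a) = Num.conj c *: star a;
  starM : forall a b : A, star (cmul a b) = cmul (star b) (star a);
  normM_le : forall a b : A, `|cmul a b| <= `|a| * `|b|;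
  norm_starM : forall a : A, `|cmul (star a) a| = `|a| ^+ 2
}.

#[short(type="cstarType")]
HB.structure Definition CStar (R : realType) :=
  {A of CompleteNormedModule R[i] A & CompleteNormedModule_isCStar R A}.

Declare Scope cstar_scope.
Delimit Scope cstar_scope with cstar.
Notation "a ** b" := (cmul a b) (at level 40, left associativity) : cstar_scope.
Local Open Scope cstar_scope.

Definition star_hom (R : realType) (A B : cstarType R) (f : A -> B) : Prop :=
  [/\ linear f, {morph f : a b / a ** b} & {morph f : a / star a}].

Definition closed_subspace (R : realType) (V : normedModType R[i])
    (W : set V) : Prop :=
  [/\ W 0, forall (c : R[i]) x y, W x -> W y -> W (c *: x + y) & closed W].

Definition cstar_subalgebra (R : realType) (A : cstarType R) (B : set A) : Prop :=
  [/\ closed_subspace B, forall a b, B a -> B b -> B (a ** b) &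
      forall a, B a -> B (star a)].

Definition closed_ideal (R : realType) (A : cstarType R) (J : set A) : Prop :=
  closed_subspace J /\ forall a b, J b -> J (a ** b) /\ J (b ** a).

(** * The universal C*-algebra *)

Definition OAN_relations (R : realType) (A : cstarType R) (s : nat -> A) : Prop :=
  [/\ forall i, s i ** star (s i) ** s i = s i,
      forall i j, i != j -> star (s i) ** s j = 0 &
      forall i, star (s i) ** s i = \sum_(k < i.+1) s k ** star (s k)].

Definition is_OAN (R : realType) (A : cstarType R) (s : nat -> A) : Prop :=
  [/\ OAN_relations s,
      forall B : set A, cstar_subalgebra B -> (forall i, B (s i)) -> B = setT &
      forall (B : cstarType R) (t : nat -> B), OAN_relations t ->
        exists f : A -> B, star_hom f /\ forall i, f (s i) = t i].

(** * Representations *)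

Definition representation (R : realType) (A : cstarType R) (H : hilbertType R)
    (pi : A -> {linear H -> H}) : Prop :=
  [/\ forall a, continuous (pi a),
      forall (c : R[i]) a b x, pi (c *: a + b) x = c *: pi a x + pi b x,
      forall a b x, pi (a ** b) x = pi a (pi b x) &
      forall a x y, inner (pi a x) y = inner x (pi (star a) y)].

(* The first clause excludes the zero representation, on the zero space as
   well as on a one-dimensional one. *)
Definition irreducible (R : realType) (A : cstarType R) (H : hilbertType R)
    (pi : A -> {linear H -> H}) : Prop :=
  (exists a x, pi a x != 0) /\
  forall V : set H, closed_subspace V -> (forall a x, V x -> V (pi a x)) ->
    V = [set 0] \/ V = setT.

Definition unitarily_equivalent (R : realType) (A : cstarType R)
    (H K : hilbertType R) (pi : A -> {linear H -> H})
    (rho : A -> {linear K -> K}) : Prop :=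
  exists U : {linear H -> K},
    [/\ forall y, exists x, U x = y,
        forall x y, inner (U x) (U y) = inner x y &
        forall a x, U (pi a x) = rho a (U x)].

(** * The weakly monotone Fock space *)

(* [:: i1; ...; ik] stands for e_i1 (x) ... (x) e_ik and [::] for the vacuum. *)
Definition wm_word (w : seq nat) : bool := sorted geq w && all (leq 1) w.

(* Values of the basis outside [wm_word] are irrelevant. *)
Record wm_fock (R : realType) := WMFock {
  fock_space :> hilbertType R;
  fock_basis : seq nat -> fock_space;
  fock_orthonormal : forall v w, wm_word v -> wm_word w ->
    inner (fock_basis v) (fock_basis w) = (v == w)%:R;
  fock_total : forall V : set fock_space, closed_subspace V ->
    (forall w, wm_word w -> V (fock_basis w)) -> V = setT
}.

Definition vacuum (R : realType) (F : wm_fock R) : F := fock_basis F [::].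

Definition vacuum_proj (R : realType) (F : wm_fock R) (x : F) : F :=
  inner x (vacuum F) *: vacuum F.

(* Characterizes a bounded operator by its values on the basis. *)
Definition is_creation (R : realType) (F : wm_fock R) (i : nat)
    (T : {linear F -> F}) : Prop :=
  [/\ continuous T,
      T (vacuum F) = fock_basis F [:: i] &
      forall i1 w, wm_word (i1 :: w) ->
        T (fock_basis F (i1 :: w)) =
          if (i1 <= i)%N then fock_basis F [:: i, i1 & w] else 0].

(** * The representations pi_{n,z} *)

(* pi_{n,z} is given by its values on the generators. They determine it
   ([pi_tilde_unique]), and the composite of pi_{0,z}, the inverse of
   Psi_n : A -> A/J_n and the quotient map A -> A/J_n has these values
   ([pi_tilde_quotient]). *)
Definition is_pi_tilde (R : realType) (A : cstarType R) (s : nat -> A)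
    (F : wm_fock R) (n : nat) (z : R[i]) (rho : A -> {linear F -> F}) : Prop :=
  [/\ representation rho,
      forall i x, (i < n)%N -> rho (s i) x = 0,
      forall x, rho (s n) x = z *: vacuum_proj x &
      forall i, (1 <= i)%N -> is_creation i (rho (s (n + i)%N))].

Definition ideal_J (R : realType) (A : cstarType R) (s : nat -> A) (n : nat) :
    set A :=
  [set a | forall J : set A, closed_ideal J ->
     (forall i, (i < n)%N -> J (s i)) -> J a].

(* [p : A -> Q] exhibits [Q] as the quotient by [ideal_J s n]. *)
Definition is_quotient_J (R : realType) (A Q : cstarType R) (s : nat -> A)
    (n : nat) (p : A -> Q) : Prop :=
  [/\ star_hom p, forall q, exists a, p a = q &
      forall a, p a = 0 <-> ideal_J s n a].

(** ** Consistency of the description of pi_{n,z} *)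

Section CStarTheory.
Variables (R : realType) (A : cstarType R).
Implicit Types a b x : A.

Lemma cmulNl a b : (- a) ** b = - (a ** b).
Proof. by rewrite -scaleN1r cmulZl scaleN1r. Qed.

Lemma cmulNr a b : a ** (- b) = - (a ** b).
Proof. by rewrite -[- b]scaleN1r cmulZr scaleN1r. Qed.

Lemma cmul0l a : 0 ** a = 0 :> A.
Proof. by have := cmulZl 0 (0 : A) a; rewrite !scale0r. Qed.

Lemma starN a : star (- a) = - star a.
Proof. by rewrite -scaleN1r starZ rmorphN rmorph1 scaleN1r. Qed.

Lemma star0 : star (0 : A) = 0.
Proof. by have := starZ 0 (0 : A); rewrite rmorph0 !scale0r. Qed.

Lemma norm_star a : `|star a| = `|a|.
Proof.
suff le b : `|b| <= `|star b|.
  by apply/eqP; rewrite eq_le le andbT -{2}[a]starK le.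
have [->|b0] := eqVneq b 0; first by rewrite normr0 normr_ge0.
have nb : 0 < `|b| by rewrite normr_gt0.
by rewrite -(ler_pM2r nb) -expr2 -norm_starM normM_le.
Qed.

Lemma expr_lt_eps (q e : R[i]) : 0 <= q -> q < 1 -> 0 < e ->
  exists N, q ^+ N < e.
Proof.
move=> q0 q1 e0.
have qE : q = (complex.Re q)%:C by rewrite RRe_real ?ger0_real.
have eE : e = (complex.Re e)%:C by rewrite RRe_real ?gtr0_real.
move: q0 q1 e0; rewrite qE eE.
move: (complex.Re q) (complex.Re e) => {qE eE} q' e'.
rewrite lecR -[1](rmorph1 (real_complex R)) !ltcR => q0 q1 e0.
have : `|q'| < 1 by rewrite ger0_norm.
move/cvg_expr => /cvgr0Pnorm_lt /(_ _ e0) [N _ /(_ N (leqnn N)) /= h].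
exists N; rewrite -rmorphXn ltcR; apply: le_lt_trans h.
exact: ler_norm.
Qed.

Section Sqrt.
Variable h : A.
Hypotheses (hsa : star h = h) (h1 : `|h| < 1).
Let q := `|h|.
Let f (w : A) : A := 2^-1 *: (h + w ** w).
Let w (k : nat) : A := iter k f 0.

Let q0 : 0 <= q. Proof. exact: normr_ge0. Qed.
Let q1 : q <= 1. Proof. exact: ltW. Qed.

Let half_norm : `|2^-1 : R[i]| = 2^-1.
Proof. by rewrite ger0_norm// invr_ge0 ler0n. Qed.

Let f_bound u : `|u| <= q -> `|f u| <= q.
Proof.
move=> uq; rewrite normrZ half_norm mulrC ler_pdivrMr ?ltr0n// mulr_natr mulr2n.
apply: le_trans (ler_normD _ _) _; rewrite lerD//.
apply: le_trans (normM_le _ _) _; apply: le_trans (ler_pM _ _ uq uq) _ => //.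
by rewrite ler_piMr.
Qed.

Let w_bound k : `|w k| <= q.
Proof. by elim: k => [|k ih]; [rewrite normr0|exact: f_bound]. Qed.

Let f_contr u v : `|u| <= q -> `|v| <= q -> `|f u - f v| <= q * `|u - v|.
Proof.
move=> uq vq; rewrite -scalerBr normrZ half_norm.
rewrite mulrC ler_pdivrMr ?ltr0n// mulr_natr mulr2n.
have -> : h + u ** u - (h + v ** v) = u ** (u - v) + (u - v) ** v.
  by rewrite cmulDr cmulDl cmulNr cmulNl addrA addrNK opprD addrACA subrr add0r.
apply: le_trans (ler_normD _ _) _; apply: lerD.
  by apply: le_trans (normM_le _ _) _; rewrite ler_wpM2r.
by apply: le_trans (normM_le _ _) _; rewrite mulrC ler_wpM2r.
Qed.

Let w_dist N n m : `|w (N + n)%N - w (N + m)%N| <= q ^+ N * (q + q).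
Proof.
elim: N => [|N ih].
  rewrite !add0n expr0 mul1r; apply: le_trans (ler_normB _ _) _.
  by rewrite lerD.
rewrite !addSn exprS -mulrA.
apply: le_trans (f_contr (w_bound _) (w_bound _)) _.
by rewrite ler_wpM2l.
Qed.

Let w_cauchy : cauchy (w @ \oo).
Proof.
apply/cauchy_ballP => e e0.
have [N hN] := expr_lt_eps q0 h1 (divr_gt0 e0 (ltr0n _ 2)).
exists ([set w k | k in [set k | (N <= k)%N]], [set w k | k in [set k | (N <= k)%N]]).
  by split; exists N => // k /= Nk; exists k.
move=> [_ _] /= [[k kN <-] [l lN <-]]; rewrite -ball_normE /=.
rewrite -(subnKC kN) -(subnKC lN); apply: le_lt_trans (w_dist _ _ _) _.
apply: (@le_lt_trans _ _ (q ^+ N * 2)).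
  by rewrite ler_wpM2l ?exprn_ge0// [2](natrD _ 1 1) lerD.
by rewrite -ltr_pdivlMr ?ltr0n.
Qed.

Lemma cstar_one_sub_sqrt : exists2 u : A, star u = u & u + u - u ** u = h.
Proof.
have /cvg_ex[u uw] : cvg (w @ \oo) by exact/cauchy_cvgP.
have near_u e : 0 < e -> exists k, `|u - w k| < e /\ `|u - w k.+1| < e.
  move=> e0; move/cvgrPdist_lt : uw => /(_ e e0) [N _ hN].
  by exists N; split; apply: hN => /=.
have small (v : A) : (forall e : R[i], 0 < e -> `|v| <= e + e) -> v = 0.
  move=> hv; apply/eqP; rewrite -normr_le0; apply/ler_addgt0Pl => e e0.
  rewrite addr0; have /hv := divr_gt0 e0 (ltr0n _ 2).
  by rewrite -splitr.
have wsa k : star (w k) = w k.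
  elim: k => [|k ih]; first exact: star0.
  rewrite [w _.+1]/(f (w k)) /f starZ starD starM hsa ih.
  by rewrite conj_Creal// ger0_real// invr_ge0 ler0n.
have uq : `|u| <= q.
  apply/ler_addgt0Pl => e e0; have [k [hk _]] := near_u _ e0.
  by rewrite -[u](subrK (w k)) (le_trans (ler_normD _ _))// lerD// ltW.
exists u.
  apply/eqP; rewrite -subr_eq0; apply/eqP; apply: small => e e0.
  have [k [hk _]] := near_u _ e0.
  apply: le_trans (ler_distD (w k) _ _) _; apply: lerD; last by rewrite distrC ltW.
  by rewrite -{1}wsa -starN -starD norm_star ltW.
have fu : u = f u.
  apply/eqP; rewrite -subr_eq0; apply/eqP; apply: small => e e0.
  have [k [hk hk1]] := near_u _ e0.
  apply: le_trans (ler_distD (w k.+1) _ _) _; apply: lerD; first exact: ltW.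
  rewrite distrC; apply: le_trans (f_contr uq (w_bound k)) _.
  apply: le_trans (ltW hk); by rewrite ler_piMl.
have : 2 *: u = h + u ** u by rewrite {1}fu /f scalerA mulfV ?scale1r ?pnatr_eq0.
by rewrite scaler_nat mulr2n => ->; rewrite addrK.
Qed.
End Sqrt.
End CStarTheory.

Section RepTheory.
Variables (R : realType) (A : cstarType R) (H : hilbertType R).
Variable (pi : A -> {linear H -> H}).
Hypothesis pi_rep : representation pi.

Lemma repD a b x : pi (a + b) x = pi a x + pi b x.
Proof. by case: pi_rep => _ h _ _; have := h 1 a b x; rewrite !scale1r. Qed.

Lemma rep0 x : pi 0 x = 0.
Proof. by apply: (addrI (pi 0 x)); rewrite -repD !addr0. Qed.

Lemma repZ c a x : pi (c *: a) x = c *: pi a x.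
Proof. by case: pi_rep => _ h _ _; have := h c a 0 x; rewrite rep0 !addr0. Qed.

Lemma repB a b x : pi (a - b) x = pi a x - pi b x.
Proof. by rewrite repD -scaleN1r repZ scaleN1r. Qed.

Lemma rep_norm_le a x : `|pi a x| <= 2 * `|a| * `|x|.
Proof.
have [_ _ piM piS] := pi_rep.
have le1 b v : `|b| < 1 -> `|pi b v| <= `|v|.
  move=> b1; have bb1 : `|star b ** b| < 1 by rewrite norm_starM expr_lt1.
  have bbsa : star (star b ** b) = star b ** b by rewrite starM starK.
  have [u usa uE] := cstar_one_sub_sqrt bbsa bb1.
  rewrite -(@ler_pXn2r _ 2) ?nnegrE// -!inner_norm.
  rewrite piS -piM -uE repB repD piM.
  set y := pi u v.
  rewrite -subr_ge0.
  suff -> : inner v v - inner v (y + y - pi u y) = inner (v - y) (v - y).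
    by rewrite inner_norm exprn_ge0.
  have vy : inner v y = inner y v by rewrite /y piS usa.
  have yv : inner v (pi u y) = inner y y by rewrite [RHS]piS usa.
  by rewrite linearBl !linearBr linearDr /= yv vy; ring.
have [->|a0] := eqVneq a 0; first by rewrite rep0 !normr0 mulr0 mul0r.
have na : 0 < 2 * `|a| by rewrite mulr_gt0 ?normr_gt0 ?ltr0n.
have nE : `|(2 * `|a|)^-1| = (2 * `|a|)^-1 by rewrite ger0_norm// invr_ge0 ltW.
have /le1 : `|(2 * `|a|)^-1 *: a| < 1.
  rewrite normrZ nE invfM -mulrA mulVf ?normr_eq0// mulr1.
  by rewrite invf_lt1 ?ltr0n// ltr1n.
move=> /(_ x); rewrite repZ normrZ nE mulrC ler_pdivrMr//.
by rewrite mulrC.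
Qed.
End RepTheory.

Lemma closed_subspace_eq (R : realType) (H : hilbertType R) (T T' : {linear H -> H}) :
  continuous T -> continuous T' -> closed_subspace [set x | T x = T' x].
Proof.
move=> Tc Tc'; split=> [|c x y /= Tx Ty|]; first by rewrite /= !linear0.
  by rewrite !linearP Tx Ty.
have -> : [set x | T x = T' x] = (fun x => T x - T' x) @^-1` [set 0].
  apply/seteqP; split=> x /= => [->|]; first by rewrite subrr.
  by move/eqP; rewrite subr_eq0 => /eqP.
apply: preimage_closed.
  by move=> x _; apply: cvgB; [exact: Tc|exact: Tc'].
by apply: accessible_closed_set1; apply: hausdorff_accessible; exact: norm_hausdorff.
Qed.

Lemma closed_subspace_rep_eq (R : realType) (A : cstarType R) (H : hilbertType R)
    (pi pi' : A -> {linear H -> H}) :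
  representation pi -> representation pi' ->
  closed_subspace [set a | forall x, pi a x = pi' a x].
Proof.
move=> pir pir'; split=> [x|c a b /= ha hb x|a cla x]; first by rewrite !rep0.
  by rewrite !repD// !repZ// ha hb.
apply/eqP; rewrite -subr_eq0 -normr_le0; apply/ler_addgt0Pl => e e0; rewrite addr0.
have t0 : 0 < 4 * (`|x| + 1) :> R[i] by rewrite mulr_gt0 ?ltr0n// ltr_wpDl.
have [b [bE /=]] := cla _ (nbhsx_ballx a _ (divr_gt0 e0 t0)).
rewrite -ball_normE /= => ab.
have -> : pi a x - pi' a x = pi (a - b) x - pi' (a - b) x.
  by rewrite !repB// bE opprB addrA addrNK.
apply: le_trans (ler_normB _ _) _.
apply: le_trans (lerD (rep_norm_le pir _ _) (rep_norm_le pir' _ _)) _.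
have -> : 2 * `|a - b| * `|x| + 2 * `|a - b| * `|x| = `|a - b| * (4 * `|x|) by ring.
apply: (@le_trans _ _ (`|a - b| * (4 * (`|x| + 1)))).
  by rewrite ler_wpM2l// ler_wpM2l ?ler0n// lerDl ler01.
by rewrite -ler_pdivlMr// ltW.
Qed.

Lemma star_hom0 (R : realType) (A B : cstarType R) (f : A -> B) :
  star_hom f -> f 0 = 0.
Proof. by case=> /(_ (-1) 0 0); rewrite scaler0 addr0 scaleN1r addNr. Qed.

Lemma pi_tilde_quotient (R : realType) (A Q : cstarType R) (s : nat -> A)
    (F : wm_fock R) (n : nat) (z : R[i]) (p : A -> Q)
    (Psi : A -> Q) (Psi_inv : Q -> A) (rho0 : A -> {linear F -> F}) :
  is_quotient_J s n p ->
  star_hom Psi -> cancel Psi Psi_inv -> cancel Psi_inv Psi ->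
  (forall i, Psi (s i) = p (s (i + n)%N)) ->
  is_pi_tilde s 0 z rho0 ->
  is_pi_tilde s n z (fun a => rho0 (Psi_inv (p a))).
Proof.
move=> [hp _ pJ] hPsi PsiK PsiVK Psis [[r0c r0l r0m r0s] _ r0n r0i].
have [plin pM pS] := hp; have [Plin PM PS] := hPsi.
have Vp i : Psi_inv (p (s (n + i)%N)) = s i by rewrite addnC -Psis PsiK.
split; first split.
- by move=> a; exact: r0c.
- move=> c a b x; rewrite -r0l; congr (rho0 _ x).
  by apply: (can_inj PsiK); rewrite Plin !PsiVK plin.
- move=> a b x; rewrite -r0m; congr (rho0 _ x).
  by apply: (can_inj PsiK); rewrite PM !PsiVK pM.
- move=> a x y; rewrite r0s; congr (inner x (rho0 _ y)).
  by apply: (can_inj PsiK); rewrite PS !PsiVK pS.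
- move=> i x ltin; have -> : p (s i) = 0 by apply/pJ => J _; exact.
  rewrite -[X in Psi_inv X](star_hom0 hPsi) PsiK.
  by have := r0l (-1) 0 0 x; rewrite scaler0 addr0 scaleN1r addNr.
- by move=> x; have := Vp 0%N; rewrite addn0 => ->.
- by move=> i i1; rewrite Vp; exact: r0i.
Qed.

Lemma pi_tilde_unique (R : realType) (A : cstarType R) (s : nat -> A)
    (F : wm_fock R) (n : nat) (z : R[i]) (rho rho' : A -> {linear F -> F}) :
  is_OAN s -> is_pi_tilde s n z rho -> is_pi_tilde s n z rho' ->
  forall a x, rho a x = rho' a x.
Proof.
move=> [_ gen _] [r r1 r2 r3] [r' r1' r2' r3'].
have [_ _ rM rS] := r; have [_ _ rM' rS'] := r'.
suff E : [set a | forall x, rho a x = rho' a x] = setT.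
  by move=> a; have : [set: A] a by []; rewrite -E.
apply: gen => [|i].
  split; first exact: closed_subspace_rep_eq.
  - by move=> a b /= ha hb x; rewrite rM rM' hb ha.
  - move=> a /= ha x; apply/eqP; rewrite -subr_eq0 -normr_eq0 -sqrf_eq0 -inner_norm.
    set y := (X in inner X X).
    by rewrite {1}/y linearBl /= rS rS' starK ha subrr.
have [iltn|nlti|->] /= := ltngtP i n => x.
- by rewrite (r1 _ _ iltn) (r1' _ _ iltn).
- have [c1 v1 b1] := r3 (i - n)%N (ltac:(by rewrite subn_gt0)).
  have [c2 v2 b2] := r3' (i - n)%N (ltac:(by rewrite subn_gt0)).
  rewrite subnKC ?(ltnW nlti)// in c1 v1 b1 c2 v2 b2.
  have V := fock_total (closed_subspace_eq c1 c2).
  have Vx : [set: F] x by [].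
  move: Vx; rewrite -V //.
  case=> [_|i1 w wm] /=; first by rewrite [LHS]v1 [RHS]v2.
  by rewrite b1 ?b2.
- by rewrite r2 r2'.
Qed.

(* Main.v *)
From HB Require Import structures.
Require Import Defs.
From mathcomp Require Import all_boot all_order all_algebra.
From mathcomp Require Import complex.
From mathcomp Require Import all_classical all_reals all_analysis.
From mathcomp Require Import ring lra.

Set Implicit Arguments.
Unset Strict Implicit.
Unset Printing Implicit Defensive.

Import Order.TTheory GRing.Theory Num.Theory.
Import numFieldNormedType.Exports.

Local Open Scope classical_set_scope.
Local Open Scope ring_scope.
Local Open Scope complex_scope.
Local Open Scope cstar_scope.

(** Let [n] be the least index with [pi (s n) <> 0]; it exists because the [s i]
    generate the algebra. Since the earlier generators act as zero, the relation
    [s_n^* s_n = sum_(k <= n) s_k s_k^*] says that [pi (s n)] is normal, and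
    unitary on the range [K] of [s_n s_n^*] ([initial_final]).

    The relations give, for [x] in [K], every [s_(n+i1) ... s_(n+ik) x] the
    behaviour of the basis vector [e_i1 (x) ... (x) e_ik] of the weakly monotone
    Fock space under the [s_(n+i)] and their adjoints, with [x] as vacuum. Hence
    a closed subspace [V] of [K] that reduces [pi (s n)] spans, under the words,
    an invariant subspace which meets [K] in [V]. Irreducibility of [pi] forces
    [V] to be [0] or [K] ([wandering_irreducible]).

    So the normal operator [pi (s n)] is irreducible on [K], and Schur's lemma
    applies: it is a scalar [z] there ([normal_scalar]), necessarily of modulus
    one, and [K] is a line spanned by a unit vector [v] ([wandering_line]).
    Schur's lemma for a normal operator needs a trace of the spectral theorem,
    namely that a self-adjoint operator [X] has disjoint positive and negative
    parts. It comes from [|X| = sqrt (X^2)], which the usual iteration for square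
    roots produces as a norm limit ([sqrt_of_square]), and from
    [(|X| - X) (|X| + X) = 0].

    Finally the vectors [s_(n+i1) ... s_(n+ik) v], indexed by the weakly
    decreasing words, are orthonormal and total ([word_act_orthonormal],
    [word_act_total]), like the basis of the Fock space. Two total families with
    the same Gram matrix are exchanged by a unitary ([unitary_of_gram]), and
    conjugating [pi] with it gives the representation [pi_(n,z)]. *)

(** * Limits, inner products and bounded operators *)

Section Approximation.
Variable R : realType.

Lemma harmonic_lt_eps (C e : R[i]) : 0 <= C -> 0 < e ->
  exists k, C / k.+1%:R < e.
Proof.
move=> C0 e0.
have h0 : 0 <= 2^-1 :> R[i] by rewrite invr_ge0 ler0n.
have h1 : 2^-1 < 1 :> R[i] by rewrite invf_lt1 ?ltr0n// ltr1n.
have [N hN] := expr_lt_eps h0 h1 (divr_gt0 e0 (ltr_wpDl C0 ltr01)).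
exists (2 ^ N).-1; rewrite prednK ?expn_gt0// natrX -exprVn.
move: hN; rewrite ltr_pdivlMr ?ltr_wpDl// => hN.
apply: le_lt_trans hN; rewrite mulrC ler_wpM2l ?exprn_ge0//.
by rewrite lerDl ler01.
Qed.

Lemma le_harmonic_eq0 (V : normedModType R[i]) (v : V) (C : R[i]) :
  (forall k, `|v| <= C / k.+1%:R) -> v = 0.
Proof.
move=> hv; apply/eqP; rewrite -normr_le0; apply/ler_addgt0Pl => e e0.
have C0 : 0 <= C by have := le_trans (normr_ge0 _) (hv 0%N); rewrite divr1.
have [k hk] := harmonic_lt_eps C0 e0.
by rewrite addr0; apply: le_trans (hv k) (ltW hk).
Qed.

(** Limits of sequences are taken with an explicit rate [C / k.+1];
    keeping the rate for the limit makes every later passage to the limit an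
    estimate that [le_harmonic_eq0] finishes. *)
Lemma harmonic_cauchy_cvg (V : completeNormedModType R[i]) (u : nat -> V)
    (C : R[i]) :
  (forall k m, (k <= m)%N -> `|u m - u k| <= C / k.+1%:R) ->
  exists l, forall k, `|l - u k| <= C / k.+1%:R.
Proof.
move=> hu.
have C0 : 0 <= C.
  by have := le_trans (normr_ge0 _) (hu 0%N 0%N (leqnn _)); rewrite divr1.
have /cauchy_cvgP /cvg_ex[l ul] : cauchy (u @ \oo).
  apply/cauchy_ballP => e e0.
  have [N hN] := harmonic_lt_eps C0 (divr_gt0 e0 (ltr0n _ 2)).
  exists ([set u k | k in [set k | (N <= k)%N]],
          [set u k | k in [set k | (N <= k)%N]]).
    by split; exists N => // k /= Nk; exists k.
  move=> [_ _] /= [[k kN <-] [m mN <-]]; rewrite -ball_normE /=.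
  apply: le_lt_trans (ler_distD (u N) _ _) _; rewrite (splitr e).
  apply: ltrD; [|rewrite distrC]; exact: le_lt_trans (hu _ _ _) hN.
exists l => k; apply/ler_addgt0Pl => e e0.
move/cvgrPdist_lt : ul => /(_ e e0) [N _ hN].
have hm := hN (maxn N k) (leq_maxl _ _).
apply: le_trans (ler_distD (u (maxn N k)) _ _) _.
by apply: lerD; [exact: ltW | exact: hu (leq_maxr _ _)].
Qed.
Lemma lipschitz_bound_continuous (V W : normedModType R[i]) (f : V -> W) (C : R[i]) :
  0 <= C -> (forall a b, `|f a - f b| <= C * `|a - b|) -> continuous f.
Proof.
move=> C0 hf a; apply/cvgrPdist_lt => e e0.
have C1 : 0 < C + 1 by rewrite ltr_wpDl.
near=> b; apply: le_lt_trans (hf _ _) _.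
apply: (@le_lt_trans _ _ ((C + 1) * `|a - b|)).
  by rewrite ler_wpM2r// lerDl ler01.
rewrite mulrC -ltr_pdivlMr//; near: b.
by apply: (@cvgr_dist_lt _ _ _ _ _ id a) => //; rewrite divr_gt0.
Unshelve. all: by end_near. Qed.

End Approximation.

Section Hilbert.
Variable R : realType.
Implicit Types H K : hilbertType R.

Lemma inner_conj H (x y : H) : inner x y = Num.conj (inner y x).
Proof. by rewrite (hermC _ x y) /= expr0 mul1r. Qed.

Lemma innerZl H c (x y : H) : inner (c *: x) y = c * inner x y.
Proof. by rewrite linearZl_LR. Qed.

Lemma innerZr H c (x y : H) : inner x (c *: y) = Num.conj c * inner x y.
Proof. by rewrite linearZr_LR. Qed.

Lemma inner_eq0 H (x : H) : inner x x = 0 -> x = 0.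
Proof. by move/eqP; rewrite inner_norm sqrf_eq0 normr_eq0 => /eqP. Qed.

(** The square of the norm of [|y|^2 x - <x, y> y] is [|y|^2] times
    [|x|^2 |y|^2 - |<x, y>|^2]. *)
Lemma inner_CS H (x y : H) : `|inner x y| <= `|x| * `|y|.
Proof.
have [->|y0] := eqVneq y 0; first by rewrite linear0r !normr0 mulr0.
rewrite -(@ler_pXn2r _ 2) ?nnegrE ?mulr_ge0// exprMn normCK.
set c := inner x y; set N := `|y| ^+ 2.
have N0 : 0 < N by rewrite exprn_gt0// normr_gt0.
have NR : Num.conj N = N by rewrite conj_Creal// gtr0_real.
rewrite -subr_ge0 -(pmulr_rge0 _ N0).
suff -> : N * (`|x| ^+ 2 * N - c * Num.conj c) =
    inner (N *: x - c *: y) (N *: x - c *: y).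
  by rewrite inner_norm exprn_ge0.
rewrite linearBl !linearBr /= !innerZl !innerZr !inner_norm NR -/c -/N.
by rewrite (inner_conj y x) -/c; ring.
Qed.

Definition bounded_op H K (T : H -> K) : Prop :=
  exists2 C : R[i], 0 <= C & forall x, `|T x| <= C * `|x|.

Lemma bounded_op_continuous H K (T : {linear H -> K}) :
  bounded_op T -> continuous T.
Proof.
move=> [C C0 hT]; apply: (lipschitz_bound_continuous C0) => x y.
by rewrite -linearB.
Qed.

(** Polarization: the norms of [x], [y], [x + y] and [x + 'i y] determine
    [inner x y]. *)
Lemma isometry_inner H K (U : {linear H -> K}) :
  (forall x, `|U x| = `|x|) -> forall x y, inner (U x) (U y) = inner x y.
Proof.
move=> Un x y.
have q v : inner (U v) (U v) = inner v v by rewrite !inner_norm Un.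
have e1 := q (x + y); have e2 := q (x + 'i *: y).
move: e1 e2; rewrite [U _]linearD [U (x + _)]linearD [U ('i *: y)]linearZ /=.
rewrite !linearDl !linearDr /= !innerZl !innerZr.
rewrite !q !conjCi => e1 e2; apply/eqP; rewrite -subr_eq0.
have i2 : 2 * 'i != 0 :> R[i] by rewrite mulf_neq0 ?neq0Ci ?pnatr_eq0.
suff : 2 * 'i * (inner (U x) (U y) - inner x y) == 0.
  by rewrite mulf_eq0 (negPf i2).
apply/eqP.
set a := inner (U x) (U y); set a' := inner x y.
move: e1 e2; set b := inner (U y) (U x); set b' := inner y x.
set X := inner x x; set Y := inner y y => e1 e2.
have -> : 2 * 'i * (a - a') = 'i * ((X + a + (b + Y)) - (X + a' + (b' + Y))) -
  ((X + - 'i * a + ('i * b + 'i * (- 'i * Y))) -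
   (X + - 'i * a' + ('i * b' + 'i * (- 'i * Y)))) by ring.
by rewrite e1 e2 !subrr mulr0 subr0.
Qed.

End Hilbert.

Section SubspaceOperations.
Variables (R : realType) (H : hilbertType R).

Lemma closed_subspaceI (V W : set H) :
  closed_subspace V -> closed_subspace W -> closed_subspace (V `&` W).
Proof.
move=> [V0 VP Vc] [W0 WP Wc]; split=> //; last exact: closedI.
by move=> c x y [Vx Wx] [Vy Wy]; split; [exact: VP | exact: WP].
Qed.

Lemma closed_subspaceD (V : set H) x y : closed_subspace V -> V x -> V y -> V (x + y).
Proof. by move=> [_ VP _] Vx Vy; rewrite -[x]scale1r; exact: VP. Qed.

Lemma closed_subspaceZ (V : set H) c x : closed_subspace V -> V x -> V (c *: x).
Proof. by move=> [V0 VP _] Vx; rewrite -[_ *: _]addr0; exact: VP. Qed.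

Lemma closed_subspaceB (V : set H) x y : closed_subspace V -> V x -> V y -> V (x - y).
Proof.
move=> cV Vx Vy; apply: closed_subspaceD => //.
by rewrite -scaleN1r; exact: closed_subspaceZ.
Qed.

End SubspaceOperations.

(** * Unitaries from equal Gram matrices *)
Section Gram.
Variable R : realType.

Definition total_family (H : hilbertType R) (I : Type) (f : I -> H) : Prop :=
  forall V : set H, closed_subspace V -> (forall i, V (f i)) -> V = setT.

Section Graph.
Variables (H K : hilbertType R) (I : Type) (f : I -> H) (g : I -> K).
Hypothesis gram : forall i j, inner (f i) (f j) = inner (g i) (g j).

Definition comb (V : hilbertType R) (e : I -> V) (L : seq (R[i] * I)) : V :=
  \sum_(p <- L) p.1 *: e p.2.

Lemma comb_cat (V : hilbertType R) (e : I -> V) L L' :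
  comb e (L ++ L') = comb e L + comb e L'.
Proof. by rewrite /comb big_cat. Qed.

Lemma comb_scale (V : hilbertType R) (e : I -> V) c L :
  comb e [seq (c * p.1, p.2) | p <- L] = c *: comb e L.
Proof.
by rewrite /comb big_map scaler_sumr; apply: eq_bigr => p _; rewrite scalerA.
Qed.

(** This is where the equality of the Gram matrices enters: the correspondence
    of finite combinations is isometric, hence so is its closure. *)
Lemma norm_comb L : `|comb g L| = `|comb f L|.
Proof.
apply: (@pexpIrn _ 2); rewrite ?nnegrE// -!inner_norm.
rewrite /comb !linear_sumlz; apply: eq_bigr => p _.
rewrite !linear_sumr; apply: eq_bigr => p' _.
by rewrite /= !innerZl !innerZr gram.
Qed.

(** The closure of the linear relation spanned by the pairs [(f i, g i)]; it is
    going to be the graph of the unitary. *)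
Definition span_graph (x : H) (y : K) : Prop :=
  forall e : R[i], 0 < e -> exists L, `|x - comb f L| < e /\ `|y - comb g L| < e.

Lemma span_graph_gen i : span_graph (f i) (g i).
Proof.
move=> e e0; exists [:: (1, i)].
by rewrite /comb !big_seq1 /= !scale1r !subrr !normr0.
Qed.

Lemma span_graphP c x y x' y' : span_graph x y -> span_graph x' y' ->
  span_graph (c *: x + x') (c *: y + y').
Proof.
move=> xy xy' e e0; have e2 : 0 < e / 2 by rewrite divr_gt0.
have c1 : 0 < `|c| + 1 by rewrite ltr_wpDl.
have [L [Lx Ly]] := xy _ (divr_gt0 e2 c1); have [L' [Lx' Ly']] := xy' _ e2.
exists ([seq (c * p.1, p.2) | p <- L] ++ L'); rewrite !comb_cat !comb_scale.
suff le (V : normedModType R[i]) (u u' v v' : V) :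
    `|u - v| < e / 2 / (`|c| + 1) -> `|u' - v'| < e / 2 ->
    `|c *: u + u' - (c *: v + v')| < e by split; apply: le.
move=> uv uv'; rewrite opprD addrACA -scalerBr.
apply: le_lt_trans (ler_normD _ _) _; rewrite (splitr e); apply: ler_ltD => //.
rewrite normrZ; apply: (@le_trans _ _ ((`|c| + 1) * `|u - v|)).
  by rewrite ler_wpM2r// lerDl ler01.
by rewrite mulrC -ler_pdivlMr// ltW.
Qed.

Lemma span_graph_norm x y : span_graph x y -> `|y| = `|x|.
Proof.
move=> xy; apply/eqP; rewrite -subr_eq0 -normr_le0.
apply/ler_addgt0Pl => e e0; rewrite addr0.
have [L [Lx Ly]] := xy _ (divr_gt0 e0 (ltr0n _ 2)).
have -> : `|y| - `|x| = (`|y| - `|comb g L|) + (`|comb f L| - `|x|).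
  by rewrite norm_comb addrA addrNK.
apply: le_trans (ler_normD _ _) _; rewrite (splitr e).
apply: lerD; apply: ltW; apply: le_lt_trans (ler_dist_dist _ _) _ => //.
by rewrite distrC.
Qed.

Lemma span_graph_inj x y y' : span_graph x y -> span_graph x y' -> y = y'.
Proof.
move=> xy xy'; have := span_graph_norm (span_graphP (-1) xy' xy).
rewrite !scaleN1r addNr normr0 => /eqP; rewrite normr_eq0 addrC subr_eq0.
by move/eqP.
Qed.

(** The domain of an isometric closed relation is closed, since the partners of
    a Cauchy sequence form a Cauchy sequence. *)
Lemma span_graph_total : total_family f -> forall x, exists y, span_graph x y.
Proof.
move=> tot x; have : [set: H] x by [].
rewrite -(tot [set x | exists y, span_graph x y])//.
  split.
  - exists 0 => e e0; exists [::].
    by rewrite /comb !big_nil !subrr !normr0.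
  - by move=> c u v [y uy] [y' vy']; exists (c *: y + y'); exact: span_graphP.
  move=> u clu.
  have /choice[X uX] k : exists p : H * K,
      `|u - p.1| < 1 / k.+1%:R /\ span_graph p.1 p.2.
    have [v [[y vy]]] := clu _ (nbhsx_ballx u _ (divr_gt0 ltr01 (ltr0n _ k.+1))).
    by rewrite -ball_normE /= => uv; exists (v, y).
  have le1 k m : (k <= m)%N -> 1 / m.+1%:R <= 1 / k.+1%:R :> R[i].
    by move=> km; rewrite !div1r lef_pV2 ?posrE ?ltr0n// ler_nat.
  have [k m km|y uy] := @harmonic_cauchy_cvg R K (fun k => (X k).2) 2.
    have := span_graph_norm (span_graphP (-1) (uX k).2 (uX m).2).
    rewrite !scaleN1r ![- _ + _]addrC => ->.
    apply: le_trans (ler_distD u _ _) _; rewrite [2](natrD _ 1 1) mulrDl.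
    apply: lerD; last exact: ltW (uX k).1.
    by rewrite distrC; apply: le_trans (le1 _ _ km); exact: ltW (uX m).1.
  exists y => e e0; have e2 : 0 < e / 2 by rewrite divr_gt0.
  have [k hk] := harmonic_lt_eps (ler0n _ 2) e2.
  have [L [Lx Ly]] := (uX k).2 _ e2; exists L; rewrite (splitr e); split.
    apply: le_lt_trans (ler_distD (X k).1 _ _) _; apply: ltrD => //.
    apply: lt_le_trans (uX k).1 _; apply: le_trans (ltW hk).
    by rewrite ler_wpM2r ?invr_ge0 ?ler0n// ler1n.
  apply: le_lt_trans (ler_distD (X k).2 _ _) _; apply: ltrD => //.
  exact: le_lt_trans (uy k) hk.
by move=> i; exists (g i); exact: span_graph_gen.
Qed.
End Graph.

Lemma span_graphC (H K : hilbertType R) (I : Type) (f : I -> H) (g : I -> K) x y :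
  span_graph f g x y -> span_graph g f y x.
Proof. by move=> xy e /xy[L [? ?]]; exists L. Qed.

(** The relation [span_graph f g] is single-valued and everywhere defined, and
    exchanging [f] and [g] transposes it, so it is the graph of a bijection. *)
Lemma unitary_of_gram (H K : hilbertType R) (I : Type) (f : I -> H) (g : I -> K) :
  (forall i j, inner (f i) (f j) = inner (g i) (g j)) ->
  total_family f -> total_family g ->
  exists (U : {linear H -> K}) (V : {linear K -> H}),
    [/\ cancel U V, cancel V U, forall x, `|U x| = `|x| & forall i, U (f i) = g i].
Proof.
move=> gram tf tg; have gram' i j := esym (gram i j).
have /choice[U xU] := span_graph_total gram tf.
have /choice[V yV] := span_graph_total gram' tg.
have Ulin : linear U.
  move=> c x y.
  exact: (span_graph_inj gram (xU _) (span_graphP c (xU x) (xU y))).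
have Vlin : linear V.
  by move=> c x y; exact: (span_graph_inj gram' (yV _) (span_graphP c (yV x) (yV y))).
pose Um := GRing.isLinear.Build _ _ _ _ U Ulin.
pose Vm := GRing.isLinear.Build _ _ _ _ V Vlin.
exists (HB.pack U Um : {linear H -> K}), (HB.pack V Vm : {linear K -> H}).
split=> [x|y|x|i] /=.
- exact: (span_graph_inj gram' (yV (U x)) (span_graphC (xU x))).
- exact: (span_graph_inj gram (xU (V y)) (span_graphC (yV y))).
- exact: (span_graph_norm gram (xU x)).
- exact: (span_graph_inj gram (xU (f i)) (@span_graph_gen _ _ _ f g i)).
Qed.
End Gram.

(** * The absolute value of a self-adjoint contraction *)

(** [r = sqrt (X^2)] is obtained as [1 - u], where [u] solves
    [2 u = (1 - X^2) + u^2]. The iteration for [u] converges in operator norm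
    although [1 - X^2] may have norm [1]: the scalar iteration [sqrt_bound],
    which is the case [1 - X^2 = 1], dominates it term by term and tends to [1]
    at the rate [2 / k.+1]. *)
Section Sqrt.
Variables (R : realType) (H : hilbertType R) (X : {linear H -> H}).
Hypothesis Xsym : forall x y, inner (X x) y = inner x (X y).
Hypothesis X1 : forall x, `|X x| <= `|x|.

Let h x := x - X (X x).

Fixpoint sqrt_iter (k : nat) (x : H) : H :=
  if k is k'.+1 then 2^-1 *: (h x + sqrt_iter k' (sqrt_iter k' x)) else 0.

Fixpoint sqrt_bound (k : nat) : R :=
  if k is k'.+1 then (1 + sqrt_bound k' ^+ 2) / 2 else 0.

Local Notation w := sqrt_iter.
Local Notation t := sqrt_bound.

Let boundS k : t k.+1 = (1 + t k ^+ 2) / 2.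
Proof. by []. Qed.

Let t_01 k : 0 <= t k <= 1.
Proof. elim: k => [|k /andP[t0 t1]] /=; [by rewrite lexx ler01|nra]. Qed.

(** [d = 1 - t] satisfies [d' = d - d^2 / 2], so [1 / d] grows by at least [1/2]
    in each step. *)
Let t_rate k : k.+1%:R * (1 - t k) <= 2.
Proof.
elim: k => [|k ih]; first by rewrite /= subr0 mul1r ler1n.
have := t_01 k; rewrite /= => /andP[t0 t1].
move: ih; rewrite -[k.+2%:R]natr1 -[k.+1%:R]natr1; set n := k%:R : R => ih.
have n0 : 0 <= n :> R by rewrite ler0n.
have -> : 1 - (1 + t k ^+ 2) / 2 = (1 - t k) * (1 + t k) / 2 by field.
nra.
Qed.

Let t_dist k m : t m - t k <= 2 / k.+1%:R.
Proof.
rewrite ler_pdivlMr ?ltr0n// mulrC.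
apply: le_trans (t_rate k); rewrite ler_wpM2l ?ler0n// lerD2r.
by case/andP: (t_01 m).
Qed.

Let half_norm : `|2^-1 : R[i]| = 2^-1.
Proof. by rewrite ger0_norm// invr_ge0 ler0n. Qed.

Let h_norm x : `|h x| <= `|x|.
Proof.
rewrite -(@ler_pXn2r _ 2) ?nnegrE// -!inner_norm /h.
rewrite linearBl !linearBr /= -(Xsym x (X x)) (Xsym (X x) x) !inner_norm.
have -> : `|x| ^+ 2 - `|X x| ^+ 2 - (`|X x| ^+ 2 - `|X (X x)| ^+ 2) =
  `|x| ^+ 2 - (`|X x| ^+ 2 + (`|X x| ^+ 2 - `|X (X x)| ^+ 2)) by ring.
rewrite gerBl addr_ge0 ?exprn_ge0// subr_ge0 ler_pXn2r ?nnegrE//.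
Qed.

Let iterS k x : w k.+1 x = 2^-1 *: (h x + w k (w k x)).
Proof. by []. Qed.

Let iter0 x : w 0 x = 0.
Proof. by []. Qed.

Let h_lin : linear h.
Proof. by move=> c x y; rewrite /h !(linearP X) opprD addrACA -scalerBr. Qed.

Let w_lin k : linear (w k).
Proof.
elim: k => [|k ih] c x y; first by rewrite /= scaler0 addr0.
by rewrite !iterS !ih h_lin addrACA -scalerDr [LHS]scalerDr !scalerA [c * _]mulrC.
Qed.

HB.instance Definition _ k := GRing.isLinear.Build _ _ _ _ (w k) (w_lin k).

Arguments sqrt_iter : simpl never.

Let w_comm (B : {linear H -> H}) k x :
  (forall y, B (X y) = X (B y)) -> B (w k x) = w k (B x).
Proof.
move=> BX; elim: k x => [|k ih] x; first by rewrite iter0 linear0.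
by rewrite !iterS linearZ linearD /= /h linearB /= !BX !ih.
Qed.

Let w_ww j k x : w j (w k x) = w k (w j x).
Proof. by apply: w_comm => y; rewrite (@w_comm X). Qed.

Let w_norm k x : `|w k x| <= (t k)%:C * `|x|.
Proof.
elim: k x => [|k ih] x; first by rewrite iter0 normr0 mul0r.
rewrite iterS /=.
have [t0 t1] := andP (t_01 k).
rewrite normrZ half_norm rmorphM /= fmorphV /= rmorphD rmorphXn /= rmorph1.
rewrite rmorph_nat mulrAC [X in _ <= X]mulrC ler_wpM2l ?invr_ge0 ?ler0n//.
apply: le_trans (ler_normD _ _) _; rewrite mulrDl mul1r lerD ?h_norm//.
apply: le_trans (ih _) _; rewrite expr2 -mulrA ler_wpM2l// ?ih//.
by rewrite lecR.
Qed.

Let w_step k x : `|w k.+1 x - w k x| <= (t k.+1 - t k)%:C * `|x|.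
Proof.
elim: k x => [|k ih] x.
  rewrite iterS /= !iter0 !subr0 addr0 normrZ half_norm expr0n /= addr0.
  rewrite rmorphM /= fmorphV /= rmorph1 rmorph_nat mul1r.
  by rewrite ler_wpM2l ?invr_ge0 ?ler0n.
have [t0 t1] := andP (t_01 k); have [t0' _] := andP (t_01 k.+1).
(* The two iterates commute, so the difference of their squares factors. *)
have -> : w k.+2 x - w k.+1 x =
    2^-1 *: (w k.+1 (w k.+1 x - w k x) + w k (w k.+1 x - w k x)).
  rewrite (iterS k.+1) [X in _ - X = _]iterS -scalerBr opprD addrACA subrr add0r.
  by rewrite [w k.+1 (_ - _)]linearB [w k (_ - _)]linearB /= (w_ww k.+1 k) addrA addrNK.
have -> : t k.+2 - t k.+1 = 2^-1 * ((t k.+1 + t k) * (t k.+1 - t k)).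
  by rewrite (boundS k.+1) [X in _ - X = _]boundS; field.
rewrite normrZ half_norm rmorphM /= fmorphV rmorph_nat -mulrA.
rewrite ler_wpM2l ?invr_ge0 ?ler0n//.
apply: le_trans (ler_normD _ _) _.
rewrite rmorphM rmorphD /= -mulrA mulrDl.
apply: lerD; apply: le_trans (w_norm _ _) _; rewrite ler_wpM2l ?lecR//; exact: ih.
Qed.

Let w_dist k m x : (k <= m)%N -> `|w m x - w k x| <= 2 * `|x| / k.+1%:R.
Proof.
move=> km; apply: (@le_trans _ _ ((t m - t k)%:C * `|x|)).
  rewrite -(subnK km) addnC; elim: (m - k)%N => [|n ih].
    by rewrite addn0 !subrr normr0 mul0r.
  rewrite addnS -[w _ x](subrK (w (k + n)%N x)) -addrA.
  apply: le_trans (ler_normD _ _) _.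
  rewrite -[t (k + n).+1](subrK (t (k + n)%N)) -addrA rmorphD mulrDl.
  by rewrite lerD// w_step.
rewrite mulrAC ler_wpM2r//.
have := t_dist k m; rewrite -lecR rmorphM /= fmorphV /= !rmorph_nat; exact.
Qed.

(** Everything that commutes with [X], or is stable under [X], behaves in the
    same way with respect to the iterates and hence to [r]. The bound on
    [x - r x] is what remains of the positivity of [r]. *)
Lemma sqrt_of_square : exists r : {linear H -> H},
  [/\ forall x, `|x - r x| <= `|x|,
      forall x, r (r x) = X (X x),
      forall B : {linear H -> H}, bounded_op B ->
        (forall x, B (X x) = X (B x)) -> forall x, B (r x) = r (B x) &
      forall V : set H, closed_subspace V -> (forall x, V x -> V (X x)) ->
        forall x, V x -> V (r x)].
Proof.
have /choice[u wu] x : exists l, forall k, `|l - w k x| <= 2 * `|x| / k.+1%:R.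
  by apply: harmonic_cauchy_cvg => k m; exact: w_dist.
have ulin : linear u.
  move=> c x y; apply/eqP; rewrite -subr_eq0; apply/eqP.
  apply: (@le_harmonic_eq0 _ _ _
    (2 * `|c *: x + y| + `|c| * (2 * `|x|) + 2 * `|y|)) => k.
  have -> : u (c *: x + y) - (c *: u x + u y) =
      (u (c *: x + y) - w k (c *: x + y)) - c *: (u x - w k x) - (u y - w k y).
    rewrite [w k (_ + _)]linearP /= -!addrA -!opprD; congr (_ - _).
    by rewrite scalerBr addrACA ![_ + (_ - _)]addrC !subrK.
  apply: le_trans (ler_normB _ _) _; rewrite mulrDl lerD//.
  apply: le_trans (ler_normB _ _) _; rewrite mulrDl lerD//.
  by rewrite normrZ -mulrA ler_wpM2l.
have u1 x : `|u x| <= `|x|.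
  apply/ler_addgt0Pl => e e0.
  have [k hk] := harmonic_lt_eps (mulr_ge0 (ler0n R[i] 2) (normr_ge0 x)) e0.
  rewrite -[u x](subrK (w k x)); apply: le_trans (ler_normD _ _) _.
  apply: lerD; first exact: le_trans (wu _ _) (ltW hk).
  apply: le_trans (w_norm _ _) _; rewrite ler_piMl// -[1](rmorph1 (real_complex R)).
  by rewrite lecR; case/andP: (t_01 k).
have ucomm (B : {linear H -> H}) : bounded_op B ->
    (forall x, B (X x) = X (B x)) -> forall x, B (u x) = u (B x).
  move=> [C C0 hB] BX x; apply/eqP; rewrite -subr_eq0; apply/eqP.
  apply: (@le_harmonic_eq0 _ _ _ (C * (2 * `|x|) + 2 * `|B x|)) => k.
  have -> : B (u x) - u (B x) = B (u x - w k x) - (u (B x) - w k (B x)).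
    by rewrite linearB /= (@w_comm B k x BX) opprB addrA addrNK.
  apply: le_trans (ler_normB _ _) _; rewrite mulrDl lerD//.
  by apply: le_trans (hB _) _; rewrite -mulrA ler_wpM2l.
have uE x : u x + u x = h x + u (u x).
  apply/eqP; rewrite -subr_eq0; apply/eqP.
  pose W k := w k : {linear H -> H}.
  apply: (@le_harmonic_eq0 _ _ _ (8 * `|x|)) => k.
  have -> : u x + u x - (h x + u (u x)) =
      2 *: (u x - w k.+1 x) - (u (u x) - w k (u x)) - w k (u x - w k x).
    have -> : w k.+1 x = 2^-1 *: (h x + w k (w k x)) by [].
    rewrite scalerBr scalerA mulfV ?pnatr_eq0// scale1r scaler_nat mulr2n.
    rewrite [w k (_ + _)]linearB /= -[X in _ = X]addrA -opprD -[X in _ = X]addrA -opprD.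
    congr (_ - _); rewrite -[RHS]addrA; congr (_ + _).
    by rewrite -!addrA addKr [RHS]addrC subrK.
  set D := k.+1%:R.
  have -> : 8 * `|x| / D = 2 * (2 * `|x| / D) + 2 * `|x| / D + 2 * `|x| / D by ring.
  apply: le_trans (ler_normB _ _) _; apply: lerD.
    apply: le_trans (ler_normB _ _) _; apply: lerD.
      rewrite normrZ ger0_norm//; apply: le_trans (ler_wpM2l _ (wu _ _)) _ => //.
rewrite -!mulrA; do 3!apply: ler_wpM2l => //.
      by rewrite lef_pV2 ?posrE ?ltr0n// ler_nat.
    apply: le_trans (wu _ _) _; rewrite ler_wpM2r ?invr_ge0 ?ler0n//.
    by rewrite ler_wpM2l// u1.
  apply: le_trans (w_norm _ _) _; apply: le_trans (wu x k).
  rewrite ler_piMl// -[1](rmorph1 (real_complex R)).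
  by rewrite lecR; case/andP: (t_01 k).
have rlin : linear (fun x => x - u x).
  by move=> c x y; rewrite ulin scalerBr opprD addrACA.
pose rm := GRing.isLinear.Build _ _ _ _ _ rlin.
exists (HB.pack (fun x => x - u x) rm : {linear H -> H}); split=> /=.
- by move=> x; rewrite opprB addrC subrK.
- move=> x; have := ulin (-1) (u x) x.
  rewrite !scaleN1r ![- _ + _]addrC => ->.
  rewrite opprB [u (u x) - _]addrC addrA -[x - _ - _]addrA -opprD uE opprD addrA.
  by rewrite subrK /h opprB addrC subrK.
- by move=> B Bb BX x; rewrite linearB /= ucomm.
move=> V cV VX x Vx; have [V0 _ Vcl] := cV.
have Vw k y : V y -> V (w k y).
  elim: k y => [|k ih] y Vy; first by rewrite iter0.
  rewrite iterS; apply: closed_subspaceZ => //.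
  apply: closed_subspaceD => //; last exact: (ih _ (ih _ Vy)).
  by apply: closed_subspaceB => //; exact: (VX _ (VX _ Vy)).
apply: closed_subspaceB => //; apply: Vcl => N /nbhs_ballP[e /= e0 Ne].
have [k hk] := harmonic_lt_eps (mulr_ge0 (ler0n R[i] 2) (normr_ge0 x)) e0.
exists (w k x); split; first exact: Vw.
by apply: Ne; rewrite -ball_normE /=; exact: le_lt_trans (wu _ _) hk.
Qed.
End Sqrt.

(** * Schur's lemma for a normal operator *)
Section Schur.
Variables (R : realType) (H : hilbertType R).

Definition irreducible_on (B : set {linear H -> H}) (K : set H) : Prop :=
  forall V : set H, closed_subspace V -> V `<=` K ->
    (forall b x, B b -> V x -> V (b x)) -> V `<=` [set 0] \/ K `<=` V.

Variables (B : set {linear H -> H}) (K : set H).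
Hypotheses (cK : closed_subspace K) (irrK : irreducible_on B K).
Hypotheses (Bb : forall b, B b -> bounded_op b)
           (BK : forall b x, B b -> K x -> K (b x)).

Section Contraction.
Variable X : {linear H -> H}.
Hypothesis Xsym : forall x y, inner (X x) y = inner x (X y).
Hypothesis X1 : forall x, `|X x| <= `|x|.
Hypothesis BX : forall b x, B b -> b (X x) = X (b x).
Hypothesis XK : forall x, K x -> K (X x).

(** With [r = |X|], the operators [r - X] and [r + X] have product [0] and their
    kernels in [K] are stable under [B]. If the kernel of [r + X] is not [K], it
    vanishes, so that [r - X], whose range lies in it, vanishes; thus [X] is
    [|X|] or [- |X|] on [K]. *)
Lemma contraction_definite :
  (forall x, K x -> 0 <= inner (X x) x) \/ (forall x, K x -> inner (X x) x <= 0).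
Proof.
have [r [r1 rr rB rV]] := sqrt_of_square Xsym X1.
have Xb : bounded_op X by exists 1 => // x; rewrite mul1r.
have rX x : X (r x) = r (X x) by rewrite rB.
have rb : bounded_op r.
  exists 2 => // x; rewrite -[r x](subrK x) [2](natrD _ 1 1) mulrDl mul1r.
  by apply: le_trans (ler_normD _ _) _; rewrite lerD// -normrN opprB.
pose Xn : {linear H -> H} := \- X.
have Xnb : bounded_op Xn by exists 1 => // x; rewrite mul1r normrN.
(* Squaring [|x - Y x| <= |x|] bounds [2 Re <Y x, x>] below by [|Y x|^2]. *)
have half (Y : {linear H -> H}) : (forall x, `|Y x| <= `|x|) ->
    (forall x, K x -> r x = Y x) -> forall x, K x ->
    0 <= inner (Y x) x + inner x (Y x).
  move=> Y1 rY x Kx; apply: le_trans (exprn_ge0 2 (normr_ge0 (Y x))) _.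
  have := r1 x; rewrite (rY x Kx) -(@ler_pXn2r _ 2) ?nnegrE// -!inner_norm.
  rewrite linearBl !linearBr /= opprB addrACA -subr_ge0.
  suff -> : inner x x - (inner x x + inner (Y x) (Y x) +
      (- inner x (Y x) - inner (Y x) x)) =
      inner (Y x) x + inner x (Y x) - inner (Y x) (Y x) by rewrite subr_ge0.
  by ring.
have [V0|KV] : [set x | r x = Xn x] `&` K `<=` [set 0] \/
    K `<=` [set x | r x = Xn x] `&` K.
- apply: irrK.
  + apply: closed_subspaceI => //.
    by apply: closed_subspace_eq; exact: bounded_op_continuous.
  + by move=> x [].
  + move=> b x Bb' [/= rx Kx]; split; last exact: BK.
    rewrite /= -(rB b (Bb Bb')) ?rx => [|y]; last exact: BX.
    by rewrite /Xn /= linearN /= BX.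
- left=> x Kx.
  have rx y : K y -> r y = X y.
    move=> Ky; apply/eqP; rewrite -subr_eq0; apply/eqP/V0; split.
      rewrite /= linearB rr /= -rX linearB /=.
      by rewrite opprB.
    by apply: closed_subspaceB (rV _ _ _ _ _) _ => //; exact: XK.
  have := half X X1 rx x Kx; rewrite Xsym -mulr2n.
  by rewrite pmulrn_lge0.
- right=> x Kx.
  have := half Xn _ _ x Kx; rewrite /Xn /= linearNl linearNr /= Xsym -mulr2n.
  rewrite pmulrn_lge0// oppr_ge0; apply=> y; last by case/KV.
  by rewrite normrN.
Qed.
End Contraction.

(** By [contraction_definite], every [T - c] with [c] real is semidefinite, so no
    [c] separates two values of the quadratic form of [T] on unit vectors of
    [K]: that form is constant, and [T] is a scalar by polarization. *)
Lemma selfadjoint_scalar (T : {linear H -> H}) :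
  bounded_op T -> (forall x y, inner (T x) y = inner x (T y)) ->
  (forall b x, B b -> b (T x) = T (b x)) -> (forall x, K x -> K (T x)) ->
  exists c : R[i], forall x, K x -> T x = c *: x.
Proof.
move=> [C C0 Tb] Tsym BT TK.
have Treal x : inner (T x) x \is Num.real.
  by apply/CrealP; rewrite -inner_conj Tsym.
have cmp c : c \is Num.real ->
    (forall x, K x -> c * `|x| ^+ 2 <= inner (T x) x) \/
    (forall x, K x -> inner (T x) x <= c * `|x| ^+ 2).
  move=> cR; (* [T - c] has norm less than [D], so [X] below is a contraction. *)
  pose D := C + `|c| + 1.
  have D0 : 0 < D by rewrite ltr_wpDl// addr_ge0.
  pose X : {linear H -> H} := D^-1 \*: (T \- (c \*: idfun)).
  have XE x : X x = D^-1 *: (T x - c *: x) by [].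
  have Dc : Num.conj D^-1 = D^-1 by rewrite conj_Creal// realV gtr0_real.
  have cc : Num.conj c = c by rewrite conj_Creal.
  have iX x : inner (X x) x = D^-1 * (inner (T x) x - c * `|x| ^+ 2).
    by rewrite XE innerZl linearBl /= innerZl inner_norm.
  have [||||h|h] := @contraction_definite X.
  - move=> x y; rewrite !XE innerZl [RHS]innerZr Dc; congr (_ * _).
    by rewrite linearBl linearBr /= innerZl [inner x (c *: y)]innerZr Tsym cc.
  - move=> x; rewrite XE normrZ gtr0_norm ?invr_gt0// mulrC ler_pdivrMr//.
    apply: le_trans (ler_normB _ _) _; rewrite normrZ [X in _ <= X]mulrC.
    by rewrite /D !mulrDl mul1r ler_wpDr// lerD2r.
  - by move=> b x Bb'; rewrite !XE linearZ linearB /= linearZ /= BT.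
  - move=> x Kx; rewrite XE; apply: closed_subspaceZ => //.
    by apply: closed_subspaceB => //; [exact: TK | exact: closed_subspaceZ].
  - left=> x Kx; have := h x Kx; rewrite iX pmulr_rge0 ?invr_gt0// subr_ge0.
    exact.
  - right=> x Kx; have := h x Kx; rewrite iX pmulr_rle0 ?invr_gt0// subr_le0.
    exact.
have [[v [Kv v0]]|noK] := pselect (exists v, K v /\ v != 0); last first.
  exists 0 => x Kx; have [->|x0] := eqVneq x 0; first by rewrite linear0 scaler0.
  by case: noK; exists x.
pose q x := inner (T x) x / `|x| ^+ 2.
have n2 (x : H) : x != 0 -> 0 < `|x| ^+ 2 :> R[i].
  by move=> x0; apply: exprn_gt0; rewrite normr_gt0.
have qR x : q x \is Num.real.
  apply: realM; first exact: Treal.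
  by apply: ger0_real; rewrite invr_ge0 exprn_ge0.
have nlt x y : K x -> x != 0 -> K y -> y != 0 -> q x < q y -> False.
  move=> Kx x0 Ky y0 qxy; have [l1 l2] := midf_lt qxy.
  have cR : (q x + q y) / 2 \is Num.real.
    by apply: realM; [exact: realD | rewrite realV realn].
  have [h|h] := cmp _ cR.
    have := h x Kx; rewrite -ler_pdivlMr ?n2// -/(q x) => /(lt_le_trans l1).
    by rewrite ltxx.
  have := h y Ky; rewrite -ler_pdivrMr ?n2// -/(q y) => /(lt_le_trans l2).
  by rewrite ltxx.
have qE x : K x -> x != 0 -> q x = q v.
  move=> Kx x0; have [lt|lt|//] := real_ltgtP (qR x) (qR v).
    by case: (nlt x v).
  by case: (nlt v x).
set c := q v in qE; exists c => y Ky.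
have [Y YE] : exists Y : {linear H -> H}, forall x, Y x = T x - c *: x.
  by exists (T \- (c \*: idfun)).
have Ysym x x' : inner (Y x) x' = inner x (Y x').
  rewrite !YE linearBl linearBr /= innerZl [inner x (c *: x')]innerZr Tsym.
  by rewrite conj_Creal// qR.
have Yx x : K x -> inner (Y x) x = 0.
  move=> Kx; rewrite YE linearBl /= innerZl inner_norm.
  have [->|x0] := eqVneq x 0; first by rewrite linear0r normr0 expr0n mulr0 subrr.
  by rewrite -(qE x)// divfK ?subrr// expf_neq0// normr_eq0.
have KY : K (Y y).
  by rewrite YE; apply: closed_subspaceB => //; [exact: TK | exact: closed_subspaceZ].
(* The form of [Y] at [y + Y y] is [2 |Y y|^2]. *)
have := Yx _ (closed_subspaceD cK Ky KY).
rewrite [Y _]linearD linearDl !linearDr /= (Yx _ Ky) (Yx _ KY) (Ysym (Y y) y).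
rewrite add0r addr0 -mulr2n => /eqP; rewrite mulrn_eq0 /= => /eqP/inner_eq0.
by rewrite YE => /eqP; rewrite subr_eq0 => /eqP.
Qed.

End Schur.

(** [S + S'] and ['i (S - S')] are self-adjoint and commute with [S] and [S'];
    being scalars on [K], they make [S] a scalar. *)
Lemma normal_scalar (R : realType) (H : hilbertType R) (K : set H)
    (S S' : {linear H -> H}) :
  closed_subspace K -> irreducible_on [set S; S'] K ->
  bounded_op S -> bounded_op S' ->
  (forall x y, inner (S x) y = inner x (S' y)) ->
  (forall x, S (S' x) = S' (S x)) ->
  (forall x, K x -> K (S x)) -> (forall x, K x -> K (S' x)) ->
  exists z : R[i], forall x, K x -> S x = z *: x.
Proof.
move=> cK irr Sb S'b adj SS SK S'K.
have adj' x y : inner (S' x) y = inner x (S y).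
  by rewrite inner_conj -adj -inner_conj.
have Bb b : [set S; S'] b -> bounded_op b by case=> ->.
have BK b x : [set S; S'] b -> K x -> K (b x) by case=> ->; [exact: SK|exact: S'K].
have [C C0 hS] := Sb; have [C' C'0 hS'] := S'b.
pose T1 : {linear H -> H} := S \+ S'.
pose T2 : {linear H -> H} := 'i \*: (S \- S').
have T1E x : T1 x = S x + S' x by [].
have T2E x : T2 x = 'i *: (S x - S' x) by [].
have [c1 h1] : exists c : R[i], forall x, K x -> T1 x = c *: x.
  apply: selfadjoint_scalar irr Bb BK _ _ _ _ _ => //.
  - exists (C + C') => [|x]; first exact: addr_ge0.
    by apply: le_trans (ler_normD _ _) _; rewrite mulrDl lerD.
  - by move=> x y; rewrite /T1 /= linearDl linearDr /= adj adj' addrC.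
  - by move=> b x [] ->; rewrite /T1 /= linearD /= SS.
  - by move=> x Kx; apply: closed_subspaceD => //; [exact: SK|exact: S'K].
have [c2 h2] : exists c : R[i], forall x, K x -> T2 x = c *: x.
  apply: selfadjoint_scalar irr Bb BK _ _ _ _ _ => //.
  - exists (C + C') => [|x]; first exact: addr_ge0.
    rewrite /T2 /= normrZ normCi mul1r.
    by apply: le_trans (ler_normB _ _) _; rewrite mulrDl lerD.
  - move=> x y; rewrite /T2 /= innerZl [RHS]innerZr linearBl linearBr /= adj adj'.
    by rewrite conjCi [inner x (_ - _)]linearBr /=; ring.
  - by move=> b x [] ->; rewrite /T2 /= linearZ linearB /= SS.
  - move=> x Kx; apply: closed_subspaceZ => //.
    by apply: closed_subspaceB => //; [exact: SK|exact: S'K].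
exists (2^-1 * (c1 - 'i * c2)) => x Kx.
rewrite -scalerA scalerBl -h1// -scalerA -h2// T1E T2E scalerA -expr2 sqrCi scaleN1r.
rewrite opprK addrACA subrr addr0 scalerDr -scalerDl -[2^-1]div1r -splitr.
by rewrite scale1r.
Qed.

(** * Closed spans and generators *)

Section ClosedSubspaces.
Variable R : realType.

Lemma closed_subspace_preimage (H K : hilbertType R) (T : {linear H -> K}) W :
  continuous T -> closed_subspace W -> closed_subspace [set x | W (T x)].
Proof.
move=> Tc [W0 WP Wc]; split; first by rewrite /= linear0.
  by move=> c x y /= Wx Wy; rewrite linearP; exact: WP.
by apply: preimage_closed => // x _; exact: Tc.
Qed.

Definition closed_span (H : hilbertType R) (E : set H) : set H :=
  [set x | forall W, closed_subspace W -> E `<=` W -> W x].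

Lemma closed_subspace_span (H : hilbertType R) (E : set H) :
  closed_subspace (closed_span E).
Proof.
split=> [W [W0 _ _]//|c x y hx hy W cW EW|x clx W cW EW].
  by have [_ WP _] := cW; apply: WP; [exact: hx | exact: hy].
have [_ _ Wc] := cW; apply: Wc; apply: closureS clx => y hy.
exact: hy.
Qed.

Lemma sub_closed_span (H : hilbertType R) (E : set H) : E `<=` closed_span E.
Proof. by move=> x Ex W _; exact. Qed.

Lemma closed_span_map (H : hilbertType R) (E : set H) (T : {linear H -> H}) W :
  continuous T -> closed_subspace W -> (forall x, E x -> W (T x)) ->
  forall x, closed_span E x -> W (T x).
Proof.
move=> Tc cW h x /(_ [set x | W (T x)]); apply; last exact: h.
exact: closed_subspace_preimage.
Qed.
End ClosedSubspaces.

Section Representations.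
Variables (R : realType) (A : cstarType R) (H : hilbertType R).
Variable pi : A -> {linear H -> H}.
Hypothesis pi_rep : representation pi.

Lemma rep_bounded a : bounded_op (pi a).
Proof. by exists (2 * `|a|) => [|x]; [exact: mulr_ge0 | exact: rep_norm_le]. Qed.

Lemma rep_sum n (F : nat -> A) x :
  pi (\sum_(k < n) F k) x = \sum_(k < n) pi (F k) x.
Proof.
elim: n => [|n ih]; first by rewrite !big_ord0 rep0.
by rewrite !big_ord_recr /= repD// ih.
Qed.

Lemma rep_eval_continuous x : continuous (fun a => pi a x).
Proof.
apply: (@lipschitz_bound_continuous _ _ _ _ (2 * `|x|)); first exact: mulr_ge0.
by move=> a b; rewrite -repB// mulrAC rep_norm_le.
Qed.

Lemma star_continuous : continuous (@star R A).
Proof.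
apply: (@lipschitz_bound_continuous _ _ _ _ 1) => // a b.
by rewrite mul1r -starN -starD norm_star.
Qed.

Lemma rep_adj a x y : inner x (pi a y) = inner (pi (star a) x) y.
Proof. by case: pi_rep => _ _ _ ->; rewrite starK. Qed.

(** The elements [a] for which [G] is stable under both [pi a] and
    [pi (star a)] form a C*-subalgebra. *)
Lemma stable_of_generators (s : nat -> A) (G : set H) :
  (forall B : set A, cstar_subalgebra B -> (forall i, B (s i)) -> B = setT) ->
  closed_subspace G ->
  (forall i x, G x -> G (pi (s i) x)) ->
  (forall i x, G x -> G (pi (star (s i)) x)) ->
  forall a x, G x -> G (pi a x).
Proof.
move=> gen cG hs hs' a; have [_ _ piM _] := pi_rep; have [G0 GP Gc] := cG.
pose B := [set a | (forall x, G x -> G (pi a x)) /\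
                   (forall x, G x -> G (pi (star a) x))].
suff : B a by case.
suff -> : B = setT by [].
apply: gen => [|i]; last by split; [exact: hs | exact: hs'].
split; first split.
- by split=> x _; rewrite ?star0 rep0.
- move=> c b d [hb hb'] [hd hd']; split=> x Gx.
    by rewrite repD// repZ//; apply: GP; [exact: hb | exact: hd].
  by rewrite starD starZ repD// repZ//; apply: GP; [exact: hb' | exact: hd'].
- move=> b clb; split=> x Gx.
    have cl : closed [set a | G (pi a x)].
      by apply: preimage_closed => // d _; exact: rep_eval_continuous.
    by apply: cl; apply: closureS clb => d [hd _]; exact: hd.
  have cl : closed [set a | G (pi (star a) x)].
    apply: preimage_closed => // d _.
    apply: (@continuous_comp A A H (@star R A) (fun e => pi e x)).
      exact: star_continuous.
    exact: rep_eval_continuous.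
  by apply: cl; apply: closureS clb => d [_ hd]; exact: hd.
- move=> b d [hb hb'] [hd hd']; split=> x Gx; rewrite ?starM piM.
    exact: hb (hd _ Gx).
  exact: hd' (hb' _ Gx).
- by move=> b [hb hb']; split; rewrite ?starK.
Qed.

Lemma rep_eq0_of_generators (s : nat -> A) :
  (forall B : set A, cstar_subalgebra B -> (forall i, B (s i)) -> B = setT) ->
  (forall i x, pi (s i) x = 0) -> forall a x, pi a x = 0.
Proof.
move=> gen s0 a; have [_ _ piM _] := pi_rep.
pose B := [set a | forall x, pi a x = 0].
suff : B a by [].
suff -> : B = setT by [].
apply: gen => //; split.
- apply: (closed_subspace_rep_eq (pi' := fun=> \0)) => //; split=> //.
  + by move=> b; exact: cst_continuous.
  + by move=> c b d x; rewrite scaler0 addr0.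
  + by move=> b x y; rewrite linear0l linear0r.
- by move=> b d b0 d0 x; rewrite piM d0 linear0.
- by move=> b b0 x; apply: inner_eq0; rewrite rep_adj starK b0 linear0l.
Qed.
End Representations.

(** * Words in the generators *)
Section Relations.
Variables (R : realType) (A : cstarType R) (s : nat -> A).
Hypothesis rel : OAN_relations s.

Lemma cmul_suml n (F : nat -> A) b :
  (\sum_(k < n) F k) ** b = \sum_(k < n) F k ** b.
Proof.
elim: n => [|n ih]; first by rewrite !big_ord0 cmul0l.
by rewrite !big_ord_recr /= cmulDl ih.
Qed.

Lemma cmul0r (a : A) : a ** 0 = 0.
Proof. by have := cmulZr 0 a (0 : A); rewrite !scale0r. Qed.

(** The initial projection of [s i] is the sum of the first range projections.
    This is the relation that turns weakly decreasing words into the only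
    nonzero ones. *)
Lemma initial_projE i j :
  star (s i) ** s i ** s j = if (j <= i)%N then s j else 0.
Proof.
have [r1 r2 r3] := rel; rewrite r3 (cmul_suml _ (fun k => s k ** star (s k))).
case: ifPn => [ji|]; last rewrite -ltnNge => ij.
  rewrite (bigD1 (Ordinal (ji : (j < i.+1)%N))) //= r1 big1 ?addr0// => k kj.
  by rewrite -cmulA r2 ?cmul0r.
rewrite big1// => k _; rewrite -cmulA r2 ?cmul0r// neq_ltn.
by rewrite (leq_trans _ ij).
Qed.

Lemma gen_mul_lt i j : (i < j)%N -> s i ** s j = 0.
Proof.
move=> ij; have [r1 _ _] := rel; rewrite -(r1 i) -cmulA -cmulA (cmulA (star _)).
by rewrite initial_projE leqNgt ij cmul0r.
Qed.
End Relations.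

Lemma wm_word_cons i j w :
  wm_word [:: i, j & w] = [&& (j <= i)%N, (1 <= i)%N & wm_word (j :: w)].
Proof.
by rewrite /wm_word /=; case: (j <= i)%N; case: (1 <= i)%N; rewrite ?andbF.
Qed.

Lemma wm_word_tail i w : wm_word (i :: w) -> wm_word w.
Proof. by case: w => // j w; rewrite wm_word_cons => /and3P[]. Qed.

Lemma wm_word_head i w : wm_word (i :: w) -> (1 <= i)%N.
Proof. by rewrite /wm_word /= => /andP[_ /andP[]]. Qed.

(** * The Fock structure of an irreducible representation *)
Section Fock.
Variables (R : realType) (A : cstarType R) (s : nat -> A) (H : hilbertType R).
Variables (pi : A -> {linear H -> H}) (n : nat).
Hypotheses (oan : is_OAN s) (pi_rep : representation pi).
Hypothesis below : forall i x, (i < n)%N -> pi (s i) x = 0.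

Let rel : OAN_relations s. Proof. by case: oan. Qed.
Let piM a b x : pi (a ** b) x = pi a (pi b x).
Proof. by case: pi_rep. Qed.
Let pic a : continuous (pi a).
Proof. by case: pi_rep. Qed.

(** The range of the projection [s n (s n)^*]; it turns out to be
    the vacuum line. *)
Definition wandering : set H := [set x | pi (s n) (pi (star (s n)) x) = x].
Local Notation K := wandering.

Fixpoint word_act (w : seq nat) (v : H) : H :=
  if w is i :: w' then pi (s (n + i)%N) (word_act w' v) else v.

Lemma closed_subspace_wandering : closed_subspace K.
Proof.
have := @closed_subspace_eq R H (pi (s n ** star (s n))) idfun (@pic _).
have -> : [set x | pi (s n ** star (s n)) x = idfun x] = K.
  by apply/seteqP; split=> x /=; rewrite /wandering /= piM.
by apply=> x; exact: cvg_id.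
Qed.

Lemma star_below i x : (i < n)%N -> pi (star (s i)) x = 0.
Proof. by move=> lt; apply: inner_eq0; rewrite -rep_adj// below// linear0r. Qed.

(** Since [s k] acts as zero for [k < n], the initial projection of [s n] is its
    range projection: [s n] is a normal operator, unitary on [wandering]. *)
Lemma initial_final x : pi (star (s n)) (pi (s n) x) = pi (s n) (pi (star (s n)) x).
Proof.
have [_ _ r3] := rel; rewrite -!piM r3.
rewrite (rep_sum pi_rep _ (fun k => s k ** star (s k))) big_ord_recr /= big1 ?add0r//.
by move=> k _; rewrite piM below.
Qed.

Lemma wandering_ran x : K (pi (s n) x).
Proof.
by rewrite /wandering /= -!piM ?cmulA; have [-> _ _] := rel.
Qed.

Lemma wandering_star x : K x -> K (pi (star (s n)) x).
Proof. by move=> Kx; rewrite /wandering /= -initial_final Kx. Qed.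

Lemma star_gen_wandering i x : (1 <= i)%N -> K x -> pi (star (s (n + i)%N)) x = 0.
Proof.
move=> i1 <-; have [_ r2 _] := rel; rewrite -piM r2 ?rep0//.
by rewrite -[X in _ != X]addn0 eqn_add2l -lt0n.
Qed.

Lemma star_gen_word i j x : i != j -> pi (star (s (n + i)%N)) (pi (s (n + j)%N) x) = 0.
Proof. by move=> ij; have [_ r2 _] := rel; rewrite -piM r2 ?rep0// eqn_add2l. Qed.

Lemma star_gen_gen i w v : wm_word (i :: w) -> K v ->
  pi (star (s (n + i)%N)) (pi (s (n + i)%N) (word_act w v)) = word_act w v.
Proof.
move=> wm Kv; rewrite -piM; case: w wm => [|j w] wm /=.
  by rewrite -[in LHS]Kv -piM initial_projE// leq_addr.
rewrite -piM initial_projE// leq_add2l.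
by move: wm; rewrite wm_word_cons => /andP[-> _].
Qed.

Lemma gen_word_lt i j w v : (i < j)%N ->
  pi (s (n + i)%N) (word_act (j :: w) v) = 0.
Proof. by move=> ij; rewrite /= -piM gen_mul_lt ?rep0// ltn_add2l. Qed.

Definition fock_gens (V : set H) : set H :=
  [set x | exists w v, [/\ wm_word w, V v & x = word_act w v]].

(** A part [V] of the wandering space that reduces [s n] generates the closed
    span [G] of the words applied to [V]: it is stable under the whole algebra
    and meets the wandering space in [V] only. *)
Section Span.
Variable V : set H.
Hypotheses (cV : closed_subspace V) (VK : V `<=` K).
Hypothesis Vs : forall x, V x -> V (pi (s n) x).
Hypothesis Vs' : forall x, V x -> V (pi (star (s n)) x).

Let G := closed_span (fock_gens V).
Let cG : closed_subspace G := closed_subspace_span _.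
Let G0 : G 0. Proof. by case: cG. Qed.

Let gensG w v : wm_word w -> V v -> G (word_act w v).
Proof. by move=> wm Vv; apply: sub_closed_span; exists w, v. Qed.

Lemma fock_span_stable a x : G x -> G (pi a x).
Proof.
apply: (stable_of_generators pi_rep (s := s)) cG _ _ a x; first by case: oan.
- move=> i; apply: closed_span_map => // _ [w [v [wm Vv ->]]].
  have [lt|/subnKC <-] := ltnP i n; first by rewrite below.
  move: (i - n)%N => m; case: w wm => [|j w] wm.
    case: m => [|m]; last exact: (gensG (w := [:: m.+1])).
    by rewrite addn0; apply: (gensG (w := [::])) => //; exact: Vs.
  have [jm|mj] := leqP j m; last by rewrite gen_word_lt.
  apply: (gensG (w := [:: m, j & w])) => //.
  by rewrite wm_word_cons jm wm (leq_trans (wm_word_head wm)).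
- move=> i; apply: closed_span_map => // _ [w [v [wm Vv ->]]].
  have [lt|/subnKC <-] := ltnP i n; first by rewrite star_below.
  move: (i - n)%N => m; case: w wm => [|j w] wm.
    case: m => [|m]; last by rewrite star_gen_wandering//; exact: VK.
    by rewrite addn0; apply: (gensG (w := [::])) => //; exact: Vs'.
  have [->|mj] := eqVneq m j; last by rewrite star_gen_word.
  rewrite [word_act _ _]/= star_gen_gen//; last exact: VK.
  by apply: gensG => //; exact: wm_word_tail wm.
Qed.

(** The range projection of [s n] kills every nonempty word and fixes [V]. *)
Lemma fock_span_wandering x : G x -> K x -> V x.
Proof.
move=> Gx Kx; rewrite -[x]Kx -piM; move: x Gx {Kx}.
apply: closed_span_map => // _ [w [v [wm Vv ->]]]; rewrite piM.
case: w wm => [|j w] wm /=; first by rewrite (VK Vv).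
rewrite -{1}[n]addn0 -[X in pi (star (s X))]addn0 star_gen_word ?linear0.
  by case: cV.
by rewrite eq_sym -lt0n; exact: wm_word_head wm.
Qed.

Lemma fock_span_full x : irreducible pi -> V x -> x != 0 -> G = setT.
Proof.
move=> [_ irr] Vx x0; have [E|//] := irr G cG fock_span_stable.
have : G x by apply: (gensG (w := [::])).
by rewrite E => /= xE; rewrite xE eqxx in x0.
Qed.
End Span.

Hypothesis irr : irreducible pi.

(** The span generated by a nonzero reducing [V] is everything by the
    irreducibility of [pi]; its intersection with the wandering space is [V]. *)
Lemma wandering_irreducible :
  irreducible_on [set (pi (s n)); (pi (star (s n)))] K.
Proof.
move=> V cV VK Vst.
have Vs x : V x -> V (pi (s n) x) by apply: Vst; left.
have Vs' x : V x -> V (pi (star (s n)) x) by apply: Vst; right.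
have [[x [Vx x0]]|no] := pselect (exists x, V x /\ x != 0).
  right=> y Ky; apply: fock_span_wandering => //.
  by rewrite (fock_span_full VK Vs Vs' irr Vx x0).
by left=> x Vx /=; apply/eqP/negPn/negP => x0; apply: no; exists x.
Qed.

(** [s n] acts on the wandering space as a scalar [z] by Schur's lemma. Then each
    of its closed subspaces is reducing, in particular the line through a unit
    vector [v]. *)
Lemma wandering_line : (exists x, pi (s n) x != 0) ->
  exists (v : H) (z : R[i]), [/\ `|v| = 1, `|z| = 1, K v,
    forall x, K x -> pi (s n) x = z *: x & forall x, K x -> x = inner x v *: v].
Proof.
move=> [x0 sx0].
have cK := closed_subspace_wandering.
have K_y := wandering_ran x0; set y := pi (s n) x0 in sx0 K_y.
have ny : 0 < `|y| by rewrite normr_gt0.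
pose v := `|y|^-1 *: y.
have Kv : K v by exact: closed_subspaceZ.
have v1 : `|v| = 1.
  by rewrite normrZ ger0_norm ?invr_ge0// mulVf// gt_eqF.
have [z zE] : exists z : R[i], forall x, K x -> pi (s n) x = z *: x.
  apply: (normal_scalar cK wandering_irreducible).
  - exact: rep_bounded.
  - exact: rep_bounded.
  - by move=> a b; rewrite rep_adj// starK.
  - by move=> a; rewrite initial_final.
  - by move=> a _; exact: wandering_ran.
  - exact: wandering_star.
have z1 : `|z| = 1.
  have : `|pi (s n) v| = `|v|.
    apply: (@pexpIrn _ 2); rewrite ?nnegrE// -!inner_norm.
    by rewrite rep_adj// initial_final Kv.
  by rewrite zE// normrZ v1 mulr1.
exists v, z; split=> // x Kx.
have z0 : z != 0 by rewrite -normr_eq0 z1 oner_eq0.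
have starE a : K a -> pi (star (s n)) a = z^-1 *: a.
  move=> Ka; rewrite -[in RHS]Ka zE; last exact: wandering_star.
  by rewrite scalerA mulVf// scale1r.
pose L x := inner x v *: v.
have Llin : linear L.
  by move=> c a b; rewrite /L linearDl /= innerZl scalerDl -scalerA.
pose Lm := GRing.isLinear.Build _ _ _ _ L Llin.
pose L' : {linear H -> H} := HB.pack L Lm.
have Lc : continuous L'.
  apply: bounded_op_continuous; exists 1 => // a.
  by rewrite /= /L normrZ v1 mulr1 mul1r -[X in _ <= X]mulr1 -v1 inner_CS.
pose W := [set a | L' a = a] `&` K.
have cW : closed_subspace W.
  apply: closed_subspaceI => //.
  by apply: (@closed_subspace_eq R H L' idfun) => // a; exact: cvg_id.
have [W0|KW] : W `<=` [set 0] \/ K `<=` W.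
  apply: wandering_irreducible => // [a []//|b a [] -> Wa]; have [_ Ka] := Wa.
    by rewrite zE//; exact: closed_subspaceZ.
  by rewrite starE//; exact: closed_subspaceZ.
  have /W0 : W v by split=> //; rewrite /= /L inner_norm v1 expr1n scale1r.
  by move=> /= v0; move: v1; rewrite v0 normr0 => /eqP; rewrite eq_sym oner_eq0.
by have [/esym] := KW x Kx.
Qed.

Section Basis.
Variable v : H.
Hypotheses (Kv : K v) (v1 : `|v| = 1) (Kline : forall x, K x -> x = inner x v *: v).

(** [s n] factors through its initial projection, the projection onto the line
    of [v]. *)
Lemma gen_rank_one z y : (forall x, K x -> pi (s n) x = z *: x) ->
  pi (s n) y = z *: (inner y v *: v).
Proof.
move=> zE; have [_ _ _ piS] := pi_rep.
rewrite -[LHS](wandering_ran y) initial_final zE; last exact: wandering_ran.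
by rewrite [in LHS](Kline (wandering_ran _)) !piS starK Kv.
Qed.

Lemma word_act_orthonormal w w' : wm_word w -> wm_word w' ->
  inner (word_act w v) (word_act w' v) = (w == w')%:R.
Proof.
elim: w w' => [|i w ih] [|j w'] wm wm'.
- by rewrite /= inner_norm v1 expr1n.
- by rewrite /= rep_adj// star_gen_wandering ?linear0l//; exact: wm_word_head wm'.
- rewrite /= inner_conj rep_adj// star_gen_wandering ?linear0l ?rmorph0//.
  exact: wm_word_head wm.
rewrite eqseq_cons [word_act _ _]/= [word_act (j :: _) _]/= rep_adj//.
have [<-|ij] := eqVneq i j; last by rewrite star_gen_word ?linear0l// eq_sym.
by rewrite star_gen_gen// ih//; apply: wm_word_tail; [exact: wm|exact: wm'].
Qed.

Lemma word_act_total (W : set H) : closed_subspace W ->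
  (forall w, wm_word w -> W (word_act w v)) -> W = setT.
Proof.
move=> cW hW; apply/seteqP; split=> // x _.
have v0 : v != 0 by rewrite -normr_eq0 v1 oner_eq0.
have Ks x' : K x' -> K (pi (s n) x') by move=> _; exact: wandering_ran.
have : [set: H] x by [].
rewrite -(fock_span_full (@subset_refl _ K) Ks wandering_star irr Kv v0).
apply=> // _ [w [u [wm Ku ->]]]; rewrite (Kline Ku).
suff -> c : word_act w (c *: v) = c *: word_act w v.
  by apply: closed_subspaceZ => //; exact: hW.
by elim: w {wm} => [|i w ih] //=; rewrite ih linearZ.
Qed.
End Basis.
End Fock.

Theorem theorem3p11 (R : realType) (A : cstarType R) (s : nat -> A)
    (F : wm_fock R) (H : hilbertType R) (pi : A -> {linear H -> H}) :
  is_OAN s -> representation pi -> irreducible pi ->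
  exists (n : nat) (z : R[i]), `|z| = 1 /\
    exists rho : A -> {linear F -> F},
      is_pi_tilde s n z rho /\ unitarily_equivalent pi rho.
Proof.
move=> oan rep irr; have [pic piL piM piS] := rep.
have ex : exists i, `[< exists x, pi (s i) x != 0 >].
  apply: contrapT => no; have [[a [x /eqP nz]] _] := irr; apply: nz.
  have [_ gen _] := oan; apply: (rep_eq0_of_generators rep gen) => i y.
  by apply/eqP/negPn/negP => nz; apply: no; exists i; apply/asboolP; exists y.
pose n := ex_minn ex.
have [nz below] : (exists x, pi (s n) x != 0) /\
    forall i x, (i < n)%N -> pi (s i) x = 0.
  rewrite /n; case: ex_minnP => m /asboolP nz min; split=> // i x im.
  apply/eqP/negPn/negP => nzi.
  have : (m <= i)%N by apply: min; apply/asboolP; exists x.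
  by rewrite leqNgt im.
have [v [z [v1 z1 Kv zE Kline]]] := wandering_line oan rep below irr nz.
exists n, z; split=> //.
pose f (w : {w | wm_word w}) := word_act s pi n (val w) v.
pose g (w : {w | wm_word w}) := fock_basis F (val w).
have gram w w' : inner (f w) (f w') = inner (g w) (g w').
  rewrite /f /g fock_orthonormal ?(valP w) ?(valP w')//.
  by rewrite (word_act_orthonormal oan rep Kv v1) ?(valP w) ?(valP w').
have ftot : total_family f.
  move=> W cW h; apply: (word_act_total oan rep below irr Kv v1 Kline) => // w wm.
  exact: (h (exist _ w wm)).
have gtot : total_family g.
  by move=> W cW h; apply: fock_total => // w wm; exact: (h (exist _ w wm)).
have [U [V [UK VK Un Uf]]] := unitary_of_gram gram ftot gtot.
have Uw w : wm_word w -> U (word_act s pi n w v) = fock_basis F w.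
  by move=> wm; have := Uf (exist _ w wm).
have Vw w : wm_word w -> V (fock_basis F w) = word_act s pi n w v.
  by move=> wm; rewrite -Uw// UK.
have Ui := isometry_inner Un.
have iV x y : inner (U x) y = inner x (V y) by rewrite -{1}[y]VK Ui.
have Uc : continuous U.
  by apply: bounded_op_continuous; exists 1 => // x; rewrite mul1r Un.
have Vc : continuous V.
  by apply: bounded_op_continuous; exists 1 => // x; rewrite mul1r -{2}[x]VK Un.
pose rho a : {linear F -> F} := U \o (pi a \o V).
have rhoE a x : rho a x = U (pi a (V x)) by [].
have rhoc a : continuous (rho a).
  by move=> x; apply: continuous_comp; [apply: continuous_comp|];
    [exact: Vc|exact: pic|exact: Uc].
exists rho; split; last first.
  exists U; split=> [y|x y|a x]; [by exists (V y) | exact: Ui | by rewrite rhoE UK].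
split.
- split=> //.
  + by move=> c a b x; rewrite !rhoE piL linearP.
  + by move=> a b x; rewrite !rhoE piM UK.
  + by move=> a x y; rewrite !rhoE iV piS -Ui VK.
- by move=> i x lt; rewrite rhoE below// linear0.
- move=> x; rewrite rhoE (gen_rank_one oan rep below Kv Kline _ zE) [LHS]linearZ /=.
  rewrite [U (_ *: v)]linearZ /=.
  rewrite /vacuum_proj /vacuum -(Uw [::])//=.
  by rewrite -[in RHS](VK x) Ui.
- move=> i i1; split; first exact: rhoc.
    by rewrite rhoE /vacuum Vw// -Uw// /wm_word /= i1.
  move=> i1' w wm; rewrite rhoE Vw//; case: ifPn => le.
    by rewrite -Uw// wm_word_cons le i1 wm.
  by rewrite (gen_word_lt n oan rep) ?linear0// ltnNge.
Qed.
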